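(* Let $c\geq1$ be an integer and $g\colon\mathbb{N}\to\mathbb{N}$ a function. Then there is a function $h[g]\colon\mathbb{N}\to\mathbb{N}$ such that for every $g$-transformation sequence $(A_1,b_1),\dots,(A_r,b_r)$ of $c$-BBPs we have $r\leq h[g](n(A_1,b_1))$.
   Context: A bare bones $c$-pair ($c$-BBP) is a pair $(A,b)$ where $A$ is a finite multiset of integers in $[1,c]$ and $b$ is a non-negative integer; $n(A,b)=2^b+\sum_{x\in A}x$ (each element counted with multiplicity). If $c\in A$, a folding of $(A,b)$ is $(A',b')$ where $A'$ is $A$ with the multiplicity of $c$ reduced by one and $b'=b+d$ for some non-negative integer $d$. If $x\in A$ with $x<c$, an extension of $(A,b)$ is $(A',b')$ where $A'$ is obtained from $A$ by removing one occurrence of $x$ and adding $d_1$ occurrences of $x+1$, and $b'=b+d_2$, for some non-negative integers $d_1,d_2$. $(A',b')$ is a $g$-transformation of $(A,b)$ if it is a folding or an extension of $(A,b)$ and $n(A',b')\leq g(n(A,b))$. A $g$-transformation sequence is a sequence of $c$-BBPs $(A_1,b_1),\dots,(A_r,b_r)$ such that for each $2\leq i\leq r$, $(A_i,b_i)$ is a $g$-transformation of $(A_{i-1},b_{i-1})$. *)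

(* Defs.v *)
From mathcomp Require Import all_boot.
From mathcomp Require Export finmap multiset.

Set Implicit Arguments.
Unset Strict Implicit.
Unset Printing Implicit Defensive.

Local Open Scope mset_scope.
Local Open Scope nat_scope.

Record bbp (c : nat) := BBP {
  bbp_mset : {mset nat};
  bbp_exp : nat;
  bbp_range : forall x, x \in bbp_mset -> 1 <= x <= c
}.

(* The big operator runs over the enumeration of the multiset, in which every
   element is repeated according to its multiplicity. *)
Definition bbp_n (c : nat) (P : bbp c) : nat :=
  2 ^ bbp_exp P + \sum_(x <- bbp_mset P) x.

Definition folding (c : nat) (P P' : bbp c) : Prop :=
  c \in bbp_mset P /\
  exists d : nat,
    bbp_mset P' = bbp_mset P `\ c /\ bbp_exp P' = bbp_exp P + d.

Definition extension (c : nat) (P P' : bbp c) : Prop :=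
  exists x : nat, [/\ x \in bbp_mset P, x < c &
    exists d1 d2 : nat,
      bbp_mset P' = (bbp_mset P `\ x) `+` msetn d1 x.+1 /\
      bbp_exp P' = bbp_exp P + d2].

Definition transformation (c : nat) (g : nat -> nat) (P P' : bbp c) : Prop :=
  (folding P P' \/ extension P P') /\ bbp_n P' <= g (bbp_n P).

(* Indices start at 0 and P0 is only the out-of-range default of nth. *)
Definition transformation_seq (c : nat) (g : nat -> nat) (s : seq (bbp c)) :
    Prop :=
  forall (P0 : bbp c) (i : nat), i.+1 < size s ->
    transformation g (nth P0 s i) (nth P0 s i.+1).

(* Main.v *)
Require Import Defs.
From mathcomp Require Import all_boot zify.

(** Every transformation consumes one occurrence of some [x] and leaves the
    multiplicities below [x] unchanged, so the vector of multiplicities decreases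
    lexicographically.  The length of a sequence acting only on elements [>= k]
    is bounded by downward induction on [k]: between two consecutive uses of [k]
    it acts only on elements [> k], hence for a bounded time, during which the
    size grows by a bounded iterate of [g]; and [k] is used at most as many times
    as its initial multiplicity, which is at most the initial size. *)

Set Implicit Arguments.
Unset Strict Implicit.
Unset Printing Implicit Defensive.

Section LexicographicDescent.

Variables (T : Type) (c : nat) (G : nat -> nat).
Variables (size_of : T -> nat) (mult : nat -> T -> nat) (R : nat -> T -> T -> Prop).

Hypothesis G_mono : {homo G : m n / m <= n}.
Hypothesis G_infl : forall n, n <= G n.
Hypothesis mult_size : forall x P, mult x P <= size_of P.
Hypothesis R_mult : forall x P P', R x P P' -> mult x P' < mult x P.
Hypothesis R_mult_below :
  forall x y P P', R x P P' -> y < x -> mult y P' <= mult y P.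
Hypothesis R_size : forall x P P', R x P P' -> size_of P' <= G (size_of P).

Inductive descent (k : nat) : nat -> T -> Prop :=
| descent0 P : descent k 0 P
| descentS r x P P' :
    k <= x <= c -> R x P P' -> descent k r P' -> descent k r.+1 P.

Lemma iter_homo r : {homo iter r G : m n / m <= n}.
Proof. by move=> m n le_mn; elim: r => //= r IHr; apply: G_mono. Qed.

Lemma iter_infl r s n : r <= s -> iter r G n <= iter s G n.
Proof.
move=> /subnK <-; elim: (s - r) => //= d IHd.
by apply: leq_trans IHd (G_infl _).
Qed.

(** Cut at the first use of [k], if any: the [r1] earlier steps act above [k], so they cannot raise
    its multiplicity, and each step up to and including the cut costs one application of [G]. *)
Lemma descent_split k r P : descent k r P ->
  descent k.+1 r P \/
  exists r1 r2 P', [/\ descent k.+1 r1 P, r = r1.+1 + r2, descent k r2 P',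
    mult k P' < mult k P & size_of P' <= iter r1.+1 G (size_of P)].
Proof.
elim=> {r P} [P|r x P P' /andP[le_kx le_xc] RP dP' IH]; first by left; constructor.
case: (ltngtP k x) le_kx => // [lt_kx|eq_kx] _; last first.
  right; exists 0, r, P'; split=> //; first by constructor.
    by rewrite eq_kx; apply: R_mult RP.
  exact: R_size RP.
have x_in : k.+1 <= x <= c by rewrite lt_kx.
case: IH => [d|[r1 [r2 [Q [d1 -> d2 mQ sQ]]]]]; first by left; apply: descentS RP d.
right; exists r1.+1, r2, Q; split=> //; first exact: descentS RP d1.
  exact: leq_trans mQ (R_mult_below RP lt_kx).
by apply: leq_trans sQ _; rewrite [X in _ <= X]iterSr; apply: iter_homo (R_size RP).
Qed.

(** A sigma type, so that bounds obtained for each multiplicity can be projected and assembled into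
    one function. *)
Definition descent_bounded k :=
  {h : nat -> nat | forall N r P, descent k r P -> size_of P <= N -> r <= h N}.

Lemma descent_bounded_pred k : descent_bounded k.+1 -> descent_bounded k.
Proof.
case=> h hP.
have F m : {f : nat -> nat | forall N r P,
    descent k r P -> size_of P <= N -> mult k P <= m -> r <= f N}.
  elim: m => [|m [f fP]].
    exists h => N r P /descent_split[d|[r1 [r2 [P' [_ _ _ mP' _]]]]] sP mP.
      exact: hP d sP.
    by move: (leq_trans mP' mP).
  (* At most [h N] steps precede the first use of [k], which adds one; what follows starts from size
     at most [iter (h N).+1 G N] and multiplicity at most [m]. *)
  exists (fun N => (h N).+1 + f (iter (h N).+1 G N)) => N r P.
  case/descent_split => [d|[r1 [r2 [P' [d1 -> d2 mP' sP']]]]] sP mP.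
    by rewrite addSn ltnW // ltnS (leq_trans (hP _ _ _ d sP)) ?leq_addr.
  have le_r1 : r1 <= h N := hP _ _ _ d1 sP.
  rewrite leq_add // (fP _ _ P') // ?(leq_trans sP') //; last first.
    by rewrite -ltnS (leq_trans mP').
  by rewrite (leq_trans (iter_homo _ sP)) // iter_infl.
(* Diagonal choice [m = N], as multiplicities are at most the size. *)
exists (fun N => sval (F N) N) => N r P d sP.
exact: (svalP (F N) _ _ _ d sP (leq_trans (mult_size _ _) sP)).
Qed.

Lemma descent_bounded0 : descent_bounded 0.
Proof.
suff bounded j k : c < k + j -> descent_bounded k by apply: (bounded c.+1 0).
(* In the base case [k] exceeds [c], so no step is possible. *)
elim: j k => [|j IHj] k; last first.
  by rewrite addnS -addSn => /IHj; apply: descent_bounded_pred.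
rewrite addn0 => lt_ck; exists (fun=> 0) => N r P [//|{}r x {}P P'].
by case/andP=> le_kx le_xc; rewrite ltnNge (leq_trans le_kx) in lt_ck.
Qed.

End LexicographicDescent.

(* A folding is the case [x = c], [d = 0]. *)
Definition consumes (c : nat) (g : nat -> nat) (x : nat) (P P' : bbp c) : Prop :=
  [/\ x \in bbp_mset P,
      exists d, bbp_mset P' = (bbp_mset P `\ x `+` msetn d x.+1)%mset
    & bbp_n P' <= g (bbp_n P)].

Lemma transformation_consumes (c : nat) (g : nat -> nat) (P P' : bbp c) :
  transformation g P P' -> exists2 x, x <= c & consumes g x P P'.
Proof.
case=> [[[cP [d [AP' _]]]|[x [xP lt_xc [d1 [d2 [AP' _]]]]]] le_n].
  exists c => //; split=> //; exists 0.
  by rewrite AP' msetn0 msetD0.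
by exists x; [exact: ltnW | split=> //; exists d1].
Qed.

Lemma consumes_mult (c : nat) (g : nat -> nat) x (P P' : bbp c) :
  consumes g x P P' -> bbp_mset P' x < bbp_mset P x.
Proof.
case=> xP [d ->] _; rewrite msetE2 msetB1E msetnE eqxx.
by move: xP; rewrite in_mset; case: eqP; lia.
Qed.

Lemma consumes_mult_below (c : nat) (g : nat -> nat) x y (P P' : bbp c) :
  consumes g x P P' -> y < x -> bbp_mset P' y <= bbp_mset P y.
Proof.
case=> xP [d ->] _ lt_yx; rewrite msetE2 msetB1E msetnE.
by case: (y =P x.+1); lia.
Qed.

Lemma mult_le_bbp_n (c : nat) x (P : bbp c) : bbp_mset P x <= bbp_n P.
Proof.
apply: leq_trans (leq_addl _ _).
(* Elements are positive, so each occurrence of [x] adds at least 1 to the sum. *)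
rewrite -count_mem_mset -sum1_count big_mkcond /= !big_seq.
by apply: leq_sum => y /(@bbp_range c P) /andP[y_gt0 _]; case: ifP.
Qed.

Lemma transformation_seq_descent (c : nat) (g : nat -> nat) (P : bbp c) s :
  transformation_seq g (P :: s) -> descent c (@consumes c g) 0 (size s) P.
Proof.
elim: s P => [|P' s IHs] P tr; first by constructor.
have [x le_xc RP] := transformation_consumes (tr P 0 isT).
by apply: (descentS _ RP) => //; apply: IHs => P0 i; apply: (tr P0 i.+1).
Qed.

Theorem theoremA6 (c : nat) (hc : 1 <= c) (g : nat -> nat) :
  exists h : nat -> nat,
    forall (P1 : bbp c) (s : seq (bbp c)),
      transformation_seq g (P1 :: s) -> size (P1 :: s) <= h (bbp_n P1).
Proof.
(* [g] is arbitrary; this majorant of it is monotone and inflationary. *)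
pose G n := n + \sum_(i < n.+1) g i.
have G_mono : {homo G : m n / m <= n}.
  move=> m n le_mn; rewrite leq_add // -!(big_mkord xpredT g).
  by rewrite [X in _ <= X](@big_cat_nat _ _ _ m.+1) //= leq_addr.
have gG n : g n <= G n by rewrite /G big_ord_recr addnA leq_addl.
have G_infl n : n <= G n by apply: leq_addr.
have R_size x (P P' : bbp c) : consumes g x P P' -> bbp_n P' <= G (bbp_n P).
  by case=> _ _ le_n; apply: leq_trans le_n (gG _).
have [h hP] :=
  @descent_bounded0 _ c G (@bbp_n c) (fun x P => bbp_mset P x) (@consumes c g)
    G_mono G_infl (@mult_le_bbp_n c) (@consumes_mult c g)
    (@consumes_mult_below c g) R_size.
(* The successor counts the initial pair: [h] bounds the number of transformations. *)
exists (fun n => (h n).+1) => P1 s /transformation_seq_descent d.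
by rewrite ltnS; apply: hP d _.
Qed.
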